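(* Let $\varepsilon>0$, $\tau\ge 0$ and $\lambda:=\tau/\varepsilon$ with $0\le\lambda\le1$. Define on $\mathcal V_{[0,1]}$ the functional $$H(u):=\left\langle u,\ \mathbf 1-2A^{-1}(I-e^{-\tau A})f-e^{-\tau A}u\right\rangle_{\mathcal V}+(\lambda-1)\langle u,\mathbf 1-u\rangle_{\mathcal V}.$$ Then $H$ has the uniform lower bound $$H(u)\ge-2\tau\|f\|_{\mathcal V}\|\mathbf 1\|_{\mathcal V}\qquad\text{for all }u\in\mathcal V_{[0,1]},$$ and $H$ is a Lyapunov functional for the SDIE scheme with fidelity forcing: if $u_n\in\mathcal V_{[0,1]}$ and $u_{n+1}$ satisfies $(1-\lambda)u_{n+1}-\mathcal S_\tau u_n+\frac\lambda2\mathbf 1=\lambda\beta_{n+1}$ for some $\beta_{n+1}\in\mathcal B(u_{n+1})$, then $H(u_{n+1})\le H(u_n)$, with equality if and only if $u_{n+1}=u_n$. In particular, $$H(u_n)-H(u_{n+1})\ge(1-\lambda)\|u_{n+1}-u_n\|_{\mathcal V}^2 .$$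
   Context: Graph setting. $G=(V,E)$ is a finite, simple, undirected, weighted, connected graph without self-loops, with weights $\omega_{ij}\ge0$, $\omega_{ij}=\omega_{ji}$, $\omega_{ii}=0$, and $\omega_{ij}>0$ iff $ij\in E$; it has at least two vertices, so all degrees $d_i:=\sum_{j\in V}\omega_{ij}$ are positive. Fix $r\in[0,1]$. $\mathcal V:=\{u:V\to\mathbb R\}$; for $X\subseteq\mathbb R$, $\mathcal V_X:=\{u:V\to X\}$. Inner product $\langle u,v\rangle_{\mathcal V}:=\sum_{i\in V}u_iv_id_i^r$ with norm $\|\cdot\|_{\mathcal V}$. Graph Laplacian: $(\Delta u)_i:=d_i^{-r}\sum_{j\in V}\omega_{ij}(u_i-u_j)$. $\mathbf 1$ and $\mathbf 0$ are the constant functions $1$ and $0$ on $V$, $I$ is the identity. Fidelity. Fixed throughout: $\mu\in\mathcal V_{[0,\infty)}\setminus\{\mathbf 0\}$ and $\tilde f\in\mathcal V_{[0,1]}$. $M:=\operatorname{diag}(\mu)$, $A:=\Delta+M$ (which is invertible), $f:=M\tilde f$. Fidelity forced diffusion: $\mathcal S_tu:=e^{-tA}u+A^{-1}(I-e^{-tA})f$ for $t\ge0$, $u\in\mathcal V$. Subdifferential set. For $u\in\mathcal V$, $\mathcal B(u)=\emptyset$ if $u\notin\mathcal V_{[0,1]}$; for $u\in\mathcal V_{[0,1]}$, $\mathcal B(u)$ is the set of $\beta\in\mathcal V$ such that for each $i\in V$: $\beta_i\in[0,\infty)$ if $u_i=0$, $\beta_i=0$ if $0<u_i<1$, and $\beta_i\in(-\infty,0]$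 if $u_i=1$. *)

(* Defs.v *)
From HB Require Import structures.
From mathcomp Require Import all_boot all_order all_algebra.
From mathcomp Require Import all_classical all_reals all_analysis.

Set Implicit Arguments.
Unset Strict Implicit.
Unset Printing Implicit Defensive.

Import Order.TTheory GRing.Theory Num.Theory.
Import numFieldNormedType.Exports.

Local Open Scope classical_set_scope.
Local Open Scope ring_scope.

(* The edge set is determined by the weights: ij is an edge iff 0 < weight i j. *)
Record wgraph (R : realType) (V : finType) := WGraph {
  weight :> V -> V -> R;
  weight_ge0 : forall i j, 0 <= weight i j;
  weight_sym : forall i j, weight i j = weight j i;
  weight_noloop : forall i, weight i i = 0;
  wgraph_connected : forall i j, connect (fun k l => 0 < weight k l) i j;
  wgraph_card : (1 < #|V|)%N
}.

(* Functions on V have type {ffun V -> R^o}; R^o, rather than R, makes this a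
   vectType over R. *)

Definition vfun_in (R : realType) (V : finType) (X : set R)
    : set {ffun V -> R^o} := [set u | forall i, X (u i)].

Definition cstV (R : realType) (V : finType) (c : R) : {ffun V -> R^o} :=
  [ffun=> c].

Definition deg (R : realType) (V : finType) (G : wgraph R V) (i : V) : R :=
  \sum_j G i j.

Definition inner (R : realType) (V : finType) (G : wgraph R V) (r : R)
    (u v : {ffun V -> R^o}) : R :=
  \sum_i u i * v i * deg G i `^ r.

Definition normV (R : realType) (V : finType) (G : wgraph R V) (r : R)
    (u : {ffun V -> R^o}) : R := Num.sqrt (inner G r u u).

Definition laplacian (R : realType) (V : finType) (G : wgraph R V) (r : R)
    (u : {ffun V -> R^o}) : {ffun V -> R^o} :=
  [ffun i => deg G i `^ (- r) * \sum_j G i j * (u i - u j)].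

Definition diagop (R : realType) (V : finType) (mu u : {ffun V -> R^o})
    : {ffun V -> R^o} := [ffun i => mu i * u i].

Definition opA (R : realType) (V : finType) (G : wgraph R V) (r : R)
    (mu u : {ffun V -> R^o}) : {ffun V -> R^o} :=
  laplacian G r u + diagop mu u.

(* [linfun B] is the bundled linear map equal to [B] when [B] is linear, and   *)
(* its [^-1] is the two-sided inverse when [B] is moreover bijective.          *)
Definition invop (R : realType) (V : finType)
    (B : {ffun V -> R^o} -> {ffun V -> R^o}) (u : {ffun V -> R^o})
    : {ffun V -> R^o} := ((linfun B)^-1)%VF u.

(* e^B u = \sum_k B^k u / k!, the limit being taken at each vertex.            *)
Definition expop (R : realType) (V : finType)
    (B : {ffun V -> R^o} -> {ffun V -> R^o}) (u : {ffun V -> R^o})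
    : {ffun V -> R^o} :=
  [ffun i => limn (series (fun k : nat => (k`!%:R)^-1 * iter k B u i : R))].

(* e^{-tA} *)
Definition expA (R : realType) (V : finType) (G : wgraph R V) (r : R)
    (mu : {ffun V -> R^o}) (t : R) (u : {ffun V -> R^o}) : {ffun V -> R^o} :=
  expop (fun v => - t *: opA G r mu v) u.

(* A^{-1} (I - e^{-tA}) f *)
Definition forcing (R : realType) (V : finType) (G : wgraph R V) (r : R)
    (mu f : {ffun V -> R^o}) (t : R) : {ffun V -> R^o} :=
  invop (opA G r mu) (f - expA G r mu t f).

Definition diffusion (R : realType) (V : finType) (G : wgraph R V) (r : R)
    (mu f : {ffun V -> R^o}) (t : R) (u : {ffun V -> R^o})
    : {ffun V -> R^o} :=
  expA G r mu t u + forcing G r mu f t.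

Definition subdiff (R : realType) (V : finType) (u : {ffun V -> R^o})
    : set {ffun V -> R^o} :=
  [set beta | vfun_in `[0, 1] u /\
    forall i, [/\ u i = 0 -> 0 <= beta i,
                  0 < u i < 1 -> beta i = 0 &
                  u i = 1 -> beta i <= 0]].

Definition lyapunov (R : realType) (V : finType) (G : wgraph R V) (r : R)
    (mu f : {ffun V -> R^o}) (tau lambda : R) (u : {ffun V -> R^o}) : R :=
  inner G r u (cstV V 1 - 2 *: forcing G r mu f tau - expA G r mu tau u)
  + (lambda - 1) * inner G r u (cstV V 1 - u).

(* Main.v *)
(* The operator A is self-adjoint and, by connectedness and mu <> 0, positive
   definite for the weighted inner product. Diagonalising it over the complex
   numbers gives a real tight frame of eigenvectors w_k with eigenvalues a_k > 0,
   in which e^{-tau A} multiplies the k-th coefficient by e^{-tau a_k} and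
   A^{-1}(I - e^{-tau A}) by (1 - e^{-tau a_k}) / a_k, which is at most tau. Hence
   e^{-tau A} is symmetric, positive definite and at most I, and the forcing term
   has norm at most tau |f|, so Cauchy-Schwarz yields the lower bound. With
   d = u_n - u_{n+1}, the scheme gives
     H(u_n) - H(u_{n+1}) = 2 lambda <d, beta> + <d, e^{-tau A} d>
                           + (1 - lambda) <d, d>,
   where <d, beta> >= 0 by definition of the subdifferential; the middle term is
   what settles the equality case when lambda = 1. *)
Require Import Defs.
From HB Require Import structures.
From mathcomp Require Import all_boot all_order all_algebra.
From mathcomp Require Import all_classical all_reals all_analysis.
From mathcomp Require Import complex ring lra.

Import Order.TTheory GRing.Theory Num.Theory.
Import numFieldNormedType.Exports.

Local Open Scope classical_set_scope.
Local Open Scope ring_scope.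

(** * Real tight frames of eigenvectors for symmetric matrices *)

(** Over [R[i]] the matrix is hermitian, so a unitary matrix diagonalises it with real spectrum. As
    [S] is real too, real and imaginary parts of an eigenvector satisfy the same eigenvalue
    equation. *)
Lemma real_symmetric_frame (R : rcfType) (V : finType) (S : V -> V -> R) :
  (forall i j, S i j = S j i) ->
  exists (J : finType) (a : J -> R) (p : J -> V -> R),
    (forall k j, \sum_i p k i * S i j = a k * p k j) /\
    (forall i j, \sum_k p k i * p k j = (i == j)%:R).
Proof.
move=> Ssym; pose n := #|V|.
pose A : 'M[R[i]]_n := \matrix_(i, j) (S (enum_val i) (enum_val j))%:C%C.
have Ah : A \is hermsymmx.
  apply: realsym_hermsym.
    apply/is_hermitianmxP; rewrite expr0 scale1r map_mx_id //.
    by apply/matrixP => i j; rewrite !mxE Ssym.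
  by apply/mxOverP => i j; rewrite mxE; apply/complex_realP; eexists.
have dreal := hermitian_spectral_diag_real Ah.
have /orthomx_spectralP Aeq := hermitian_normalmx Ah.
set U := spectralmx A in Aeq; set d := spectral_diag A in dreal Aeq.
have UU : U \is unitarymx := spectral_unitarymx A.
have UA : U *m A = diag_mx d *m U.
  by rewrite {1}Aeq !mulmxA mulmxV ?mul1mx // unitarymx_unit.
(* Orthonormality of the columns, not of the rows, yields the frame identity once real parts are
   taken. *)
have U1 : (map_mx Num.conj U^T) *m U = 1%:M.
  by rewrite -invmx_unitary // mulVmx // unitarymx_unit.
have eqUA k j : \sum_l U k l * A l j = (complex.Re (d ord0 k))%:C%C * U k j.
  have /matrixP /(_ k j) := UA; rewrite mul_diag_mx !mxE => ->.
  by rewrite RRe_real // (mxOverP dreal).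
have ReS (T : finType) (F : T -> R[i]) :
    complex.Re (\sum_k F k) = \sum_k complex.Re (F k).
  by apply: (big_morph _ _ _) => [[x y] [z t]|].
have ImS (T : finType) (F : T -> R[i]) :
    complex.Im (\sum_k F k) = \sum_k complex.Im (F k).
  by apply: (big_morph _ _ _) => [[x y] [z t]|].
(* The real and the imaginary parts of the rows of U together form a tight
   frame, which makes a real eigenbasis unnecessary. *)
pose p (k : 'I_n) (b : bool) i :=
  (if b then complex.Re (R:=R) else complex.Im (R:=R)) (U k (enum_rank i)).
exists ('I_n * bool)%type, (fun k => complex.Re (d ord0 k.1)).
exists (fun k => p k.1 k.2).
rewrite /p; split=> [[k [|]] j|i j] /=.
- have /(congr1 (@complex.Re R)) := eqUA k (enum_rank j).
  rewrite ReS; case: (U k (enum_rank j)) => x y /=.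
  rewrite mul0r subr0 => <-; rewrite (reindex _ (onW_bij _ (@enum_val_bij V))).
  apply: eq_bigr => l _; rewrite mxE enum_valK enum_rankK.
  by case: (U k l) => z t /=; rewrite mulr0 subr0.
- have /(congr1 (@complex.Im R)) := eqUA k (enum_rank j).
  rewrite ImS; case: (U k (enum_rank j)) => x y /=.
  rewrite mul0r addr0 => <-; rewrite (reindex _ (onW_bij _ (@enum_val_bij V))).
  apply: eq_bigr => l _; rewrite mxE enum_valK enum_rankK.
  by case: (U k l) => z t /=; rewrite mulr0 add0r.
- have /matrixP /(_ (enum_rank i) (enum_rank j)) /(congr1 (@complex.Re R)) := U1.
  rewrite !mxE ReS (inj_eq enum_rank_inj) => E.
  transitivity (complex.Re ((i == j)%:R : R[i])); last by case: (i == j).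
  rewrite -E -(pair_bigA _ (fun k b => p k b i * p k b j)) /=.
  apply: eq_bigr => k _; rewrite big_bool /p /= !mxE.
  case: (U k (enum_rank i)) => x y; case: (U k (enum_rank j)) => z t /=.
  by rewrite mulNr opprK.
Qed.

(** * The weighted inner product *)

Section InnerProduct.
Context {R : realType} {V : finType} (G : wgraph R V) (r : R).
Implicit Types (u v w : {ffun V -> R^o}) (i j : V).

(** A path from [i] to a second vertex must start with an edge of positive weight. *)
Lemma deg_gt0 i : 0 < deg G i.
Proof.
have [j ij] : exists j, j != i.
  have := wgraph_card G; rewrite (cardD1 i) add1n ltnS => /card_gt0P[j].
  by rewrite !inE => /andP[? _]; exists j.
have /connectP[[|k p] /= ] := wgraph_connected G i j.
  by move=> _ e; rewrite e eqxx in ij.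
move=> /andP[ik _] _; rewrite /deg (bigD1 k) //=.
by rewrite ltr_wpDr // sumr_ge0 // => l _; exact: weight_ge0.
Qed.

Lemma vweight_gt0 i : 0 < deg G i `^ r.
Proof. exact/powR_gt0/deg_gt0. Qed.

Lemma innerC u v : inner G r u v = inner G r v u.
Proof. by apply: eq_bigr => i _; rewrite (mulrC (u i)). Qed.

Lemma innerDr u v w : inner G r u (v + w) = inner G r u v + inner G r u w.
Proof. by rewrite -big_split; apply: eq_bigr => i _; rewrite ffunE /=; ring. Qed.

Lemma innerZr c u v : inner G r u (c *: v) = c * inner G r u v.
Proof.
rewrite /inner big_distrr; apply: eq_bigr => i _ /=.
by rewrite ffunE -[c *: v i]/(c * v i); ring.
Qed.

Lemma inner0r u : inner G r u 0 = 0.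
Proof. by apply: big1 => i _; rewrite ffunE mulr0 mul0r. Qed.

Lemma innerNr u v : inner G r u (- v) = - inner G r u v.
Proof. by rewrite -scaleN1r innerZr mulN1r. Qed.

Lemma innerDl u v w : inner G r (u + v) w = inner G r u w + inner G r v w.
Proof. by rewrite innerC innerDr 2!(innerC w). Qed.

Lemma innerZl c u v : inner G r (c *: u) v = c * inner G r u v.
Proof. by rewrite innerC innerZr innerC. Qed.

Lemma innerNl u v : inner G r (- u) v = - inner G r u v.
Proof. by rewrite innerC innerNr innerC. Qed.

Lemma inner0l u : inner G r 0 u = 0.
Proof. by rewrite innerC inner0r. Qed.

Lemma inner_ge0 u : 0 <= inner G r u u.
Proof.
by apply: sumr_ge0 => i _; rewrite mulr_ge0 ?powR_ge0 // -expr2 sqr_ge0.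
Qed.

Lemma inner_eq0 u : inner G r u u = 0 -> u = 0.
Proof.
move=> u0; apply/ffunP => i; rewrite ffunE.
have /eqP : u i * u i * deg G i `^ r = 0.
  apply: (psumr_eq0P _ u0) => // j _.
  by rewrite mulr_ge0 ?powR_ge0 // -expr2 sqr_ge0.
by rewrite mulf_eq0 (gt_eqF (vweight_gt0 i)) orbF mulf_eq0 orbb => /eqP.
Qed.

Lemma inner_le_norm u v : inner G r u v <= normV G r u * normV G r v.
Proof.
pose x := normV G r u; pose y := normV G r v; rewrite -/x -/y.
have x0 : 0 <= x by exact: sqrtr_ge0.
have y0 : 0 <= y by exact: sqrtr_ge0.
have xE : inner G r u u = x ^+ 2 by rewrite sqr_sqrtr // inner_ge0.
have yE : inner G r v v = y ^+ 2 by rewrite sqr_sqrtr // inner_ge0.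
have [x00|xn0] := eqVneq x 0.
  have -> : u = 0 by apply: inner_eq0; rewrite xE x00 expr0n.
  by rewrite inner0l mulr_ge0.
have [y00|yn0] := eqVneq y 0.
  have -> : v = 0 by apply: inner_eq0; rewrite yE y00 expr0n.
  by rewrite inner0r mulr_ge0.
have xy0 : 0 < 2 * (x * y) by rewrite !mulr_gt0 // lt_def ?xn0 ?yn0.
(* Expands to 2xy(xy - <u, v>) >= 0; zero norms were set aside so that 2xy cancels. *)
have := inner_ge0 (y *: u - x *: v).
rewrite !(innerDl, innerDr, innerNl, innerNr, innerZl, innerZr) xE yE (innerC v).
by move=> H; rewrite -(ler_pM2l xy0); lra.
Qed.

Lemma cvg_inner (x : nat -> {ffun V -> R^o}) v u :
  (forall i, (x n i : R) @[n --> \oo] --> (u i : R)) ->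
  inner G r v (x n) @[n --> \oo] --> inner G r v u.
Proof.
move=> xu; apply: cvg_big => [|i _]; first exact: add_continuous.
by apply: cvgM; [apply: cvgM; [exact: cvg_cst|exact: xu]|exact: cvg_cst].
Qed.

Definition delta j : {ffun V -> R^o} := [ffun i => (i == j)%:R].

Lemma inner_delta j u : inner G r (delta j) u = u j * deg G j `^ r.
Proof.
rewrite /inner (bigD1 j) //= ffunE eqxx mul1r big1 ?addr0 // => i /negPf ij.
by rewrite ffunE ij !mul0r.
Qed.

Lemma delta_sum u : u = \sum_j u j *: delta j.
Proof.
apply/ffunP => i; rewrite sum_ffunE (bigD1 i) //= ffunE ffunE eqxx.
rewrite big1 ?addr0 => [|j /negPf ji]; first by rewrite -[RHS]/(u i * 1) mulr1.
by rewrite !ffunE eq_sym ji -[LHS]/(u j * 0) mulr0.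
Qed.

End InnerProduct.

(** * Eigenframes and the exponential series *)

Section Eigenframe.
Context {R : realType} {V : finType} (G : wgraph R V) (r : R).
Implicit Types (u v w : {ffun V -> R^o}) (i j : V).

(* For self-adjoint A the second condition says A w_k = a_k w_k. The w_k may
   vanish and need not be orthogonal: only Parseval's identity is used. *)
Definition eigenframe (A : {ffun V -> R^o} -> {ffun V -> R^o}) {J : finType}
    (a : J -> R) (w : J -> {ffun V -> R^o}) : Prop :=
  [/\ forall k, 0 < a k,
      forall k u, inner G r (w k) (A u) = a k * inner G r (w k) u
    & forall u v,
        inner G r u v = \sum_k inner G r (w k) u * inner G r (w k) v].

Lemma selfadjoint_eigenframe
    (A : {linear {ffun V -> R^o} -> {ffun V -> R^o}}) :
  (forall u v, inner G r u (A v) = inner G r (A u) v) ->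
  (forall u, u != 0 -> 0 < inner G r u (A u)) ->
  exists (J : finType) (a : J -> R) (w : J -> {ffun V -> R^o}),
    eigenframe A a w.
Proof.
move=> Asym Apos.
pose s i : R := Num.sqrt (deg G i `^ r).
have s_gt0 i : 0 < s i by rewrite sqrtr_gt0 vweight_gt0.
have s2 i : deg G i `^ r = s i ^+ 2 by rewrite sqr_sqrtr // ltW ?vweight_gt0.
(* The matrix of D A D^-1 with D = diag(s): weighted self-adjointness becomes plain symmetry, and
   D^-1 carries the frame of [S] back to [w]. *)
pose S i j := inner G r (delta i) (A (delta j)) / (s i * s j).
have Ssym i j : S i j = S j i.
  by rewrite /S Asym innerC (mulrC (s i)).
have [J [a [p [pS pp]]]] := real_symmetric_frame _ _ S Ssym.
pose w k : {ffun V -> R^o} := [ffun i => p k i / s i].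
have wE k u : inner G r (w k) u = \sum_i p k i * (s i * u i).
  apply: eq_bigr => i _; rewrite ffunE s2.
  by field; rewrite gt_eqF.
have wA k u : inner G r (w k) (A u) = a k * inner G r (w k) u.
  rewrite !wE [in LHS](delta_sum u) linear_sum mulr_sumr.
  transitivity (\sum_i \sum_j p k i * S i j * (s j * u j)).
    apply: eq_bigr => i _; rewrite sum_ffunE !mulr_sumr.
    apply: eq_bigr => j _; rewrite linearZ ffunE /S inner_delta s2.
    rewrite -[u j *: _]/(u j * _); field.
    by rewrite !gt_eqF.
  rewrite exchange_big; apply: eq_bigr => j _ /=.
  by rewrite -mulr_suml pS -mulrA.
have par u v : inner G r u v = \sum_k inner G r (w k) u * inner G r (w k) v.
  transitivity (\sum_i \sum_j (s i * u i) * (s j * v j) * (i == j)%:R).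
    apply: eq_bigr => i _; rewrite (bigD1 i) //= eqxx mulr1 s2.
    rewrite big1 ?addr0; first by ring.
    by move=> j /negPf; rewrite eq_sym => ->; rewrite mulr0.
  under [RHS]eq_bigr do rewrite !wE mulr_suml.
  rewrite [RHS]exchange_big; apply: eq_bigr => i _ /=.
  under [RHS]eq_bigr do rewrite mulr_sumr.
  rewrite [RHS]exchange_big; apply: eq_bigr => j _ /=.
  by rewrite -pp mulr_sumr; apply: eq_bigr => k _; ring.
(* Positivity of [A] says nothing about [a k] when [w k] vanishes, so 1 is put there; both sides of
   the eigenvalue relation are then 0. *)
exists J, (fun k => if w k == 0 then 1 else a k), w; split=> // [k|k u].
  case: eqVneq => // wk0; have := Apos _ wk0; rewrite wA pmulr_lgt0 //.
  rewrite lt_def inner_ge0 andbT; apply: contra wk0 => /eqP /inner_eq0 ->.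
  by rewrite eqxx.
case: eqVneq => // ->.
by rewrite !inner0l mulr0.
Qed.

Section Frame.
Context {A : {ffun V -> R^o} -> {ffun V -> R^o}} {J : finType} {a : J -> R}
  {w : J -> {ffun V -> R^o}}.
Context (Aframe : eigenframe A a w).

(** Pairing with [w k] turns the partial sums of the operator series into those of a scalar
    exponential; uniqueness of limits concludes. *)
Lemma inner_expop k t u :
  inner G r (w k) (expop (fun v => - t *: A v) u)
    = expR (- t * a k) * inner G r (w k) u.
Proof.
case: Aframe => _ wA par.
set B := fun v => _.
have wB l n : inner G r (w l) (iter n B u) =
    (- t * a l) ^+ n * inner G r (w l) u.
  elim: n => [|n IHn]; first by rewrite mul1r.
  by rewrite iterS innerZr wA IHn exprS !mulrA.
pose s n : {ffun V -> R^o} := \sum_(0 <= m < n) (m`!%:R)^-1 *: iter m B u.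
have ws l n : inner G r (w l) (s n) =
    series (exp_coeff (- t * a l)) n * inner G r (w l) u.
  rewrite /series /= mulr_suml /s.
  elim: n => [|n IHn]; first by rewrite !big_geq // inner0r.
  rewrite !big_nat_recr //= innerDr IHn innerZr wB /exp_coeff /=.
  by ring.
have wscvg l : inner G r (w l) (s n) @[n --> \oo] -->
    expR (- t * a l) * inner G r (w l) u.
  under eq_fun do rewrite ws.
  by apply: cvgMl; exact: is_cvg_series_exp_coeff.
(* [limn] is meaningful only under convergence. By Parseval against [delta i], the value at [i] is a
   fixed finite combination of the convergent frame coefficients. *)
have scvg i : cvgn (fun n => s n i : R).
  have -> : (fun n => s n i : R) = fun n =>
      \sum_l inner G r (w l) (delta i) / deg G i `^ r * inner G r (w l) (s n).
    apply/funext => n; transitivity (inner G r (delta i) (s n) / deg G i `^ r).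
      by rewrite inner_delta mulfK // gt_eqF ?vweight_gt0.
    by rewrite par mulr_suml; apply: eq_bigr => l _; rewrite mulrAC.
  apply: cvgP; apply: cvg_big => [|l _]; first exact: add_continuous.
  by apply: cvgMr; exact: wscvg.
have sE i : series (fun n => (n`!%:R)^-1 * iter n B u i : R) = (fun n => s n i).
  apply/funext => n; rewrite /series /= /s sum_ffunE.
  by apply: eq_bigr => m _; rewrite ffunE.
have := wscvg k; apply: cvg_unique => //.
by apply: cvg_inner => i; rewrite ffunE sE; exact: scvg.
Qed.

End Frame.
End Eigenframe.

(** * Symmetry, positivity and inversion of A *)

Section OperatorA.
Context {R : realType} {V : finType} (G : wgraph R V) (r : R).
Context (mu : {ffun V -> R^o}).
Implicit Types (u v : {ffun V -> R^o}) (i j : V).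

Lemma opA_is_linear : linear (opA G r mu).
Proof.
move=> c u v; apply/ffunP => i; rewrite !ffunE.
rewrite -[X in _ = X + _]/(c * _) mulrDr !mulr_sumr.
rewrite -[c *: u i]/(c * u i).
transitivity (\sum_j (c * (deg G i `^ (- r) * (G i j * (u i - u j)))
    + deg G i `^ (- r) * (G i j * (v i - v j))) + (mu i * (c * u i) + mu i * v i)).
  congr (_ + _); apply: eq_bigr => j _; rewrite !ffunE.
  by rewrite -[c *: u j]/(c * u j); ring.
by rewrite big_split mulrDr mulr_sumr /=; ring.
Qed.

HB.instance Definition _ :=
  GRing.isLinear.Build R {ffun V -> R^o} {ffun V -> R^o} *:%R (opA G r mu)
    opA_is_linear.

(** Discrete Green formula: the Laplacian term is averaged with its copy under exchange of [i] and
    [j]. Symmetry and positivity can then be read off. *)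
Lemma inner_opA u v : inner G r u (opA G r mu v) =
  2^-1 * (\sum_i \sum_j G i j * ((u i - u j) * (v i - v j)))
  + \sum_i mu i * (u i * v i) * deg G i `^ r.
Proof.
transitivity (\sum_i \sum_j G i j * (u i * (v i - v j))
  + \sum_i mu i * (u i * v i) * deg G i `^ r).
  rewrite -big_split; apply: eq_bigr => i _ /=; rewrite !ffunE powRN.
  transitivity (u i * \sum_j G i j * (v i - v j) + mu i * (u i * v i) * deg G i `^ r).
    by field; rewrite gt_eqF ?vweight_gt0.
  by congr (_ + _); rewrite mulr_sumr; apply: eq_bigr => j _; ring.
congr (_ + _).
set X := LHS; have XE : X = \sum_i \sum_j G i j * (u j * (v j - v i)).
  rewrite /X exchange_big; apply: eq_bigr => i _; apply: eq_bigr => j _.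
  by rewrite weight_sym.
transitivity (2^-1 * (X + X)); first by field.
rewrite {2}XE /X -big_split; congr (_ * _).
by apply: eq_bigr => i _; rewrite -big_split; apply: eq_bigr => j _ /=; ring.
Qed.

Lemma opA_sym u v : inner G r u (opA G r mu v) = inner G r (opA G r mu u) v.
Proof.
rewrite [RHS]innerC !inner_opA; congr (_ * _ + _).
  by apply: eq_bigr => i _; apply: eq_bigr => j _; rewrite (mulrC (u i - u j)).
by apply: eq_bigr => i _; rewrite (mulrC (u i)).
Qed.

Context (mu_ge0 : vfun_in `[0, +oo[ mu) (mu_neq0 : mu <> cstV V 0).

(** If the form vanishes, [u] agrees across every edge, hence is constant by connectedness; a vertex
    with [mu i != 0] makes that constant 0. *)
Lemma opA_posdef u : u != 0 -> 0 < inner G r u (opA G r mu u).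
Proof.
have mu0 i : 0 <= mu i by have := mu_ge0 i; rewrite /= in_itv /= andbT.
have G0 i j : 0 <= G i j * ((u i - u j) * (u i - u j)).
  by rewrite mulr_ge0 ?weight_ge0 // -expr2 sqr_ge0.
have M0 i : 0 <= mu i * (u i * u i) * deg G i `^ r.
  by rewrite mulr_ge0 ?powR_ge0 // mulr_ge0 ?mu0 // -expr2 sqr_ge0.
have GG0 : 0 <= \sum_i \sum_j G i j * ((u i - u j) * (u i - u j)).
  by rewrite sumr_ge0 // => i _; rewrite sumr_ge0.
have MM0 : 0 <= \sum_i mu i * (u i * u i) * deg G i `^ r by rewrite sumr_ge0.
rewrite inner_opA => un0; rewrite lt_def; apply/andP; split; last first.
  by rewrite addr_ge0 // mulr_ge0 // invr_ge0.
apply: contra un0; rewrite paddr_eq0 ?mulr_ge0 ?invr_ge0 //.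
rewrite mulf_eq0 invr_eq0 pnatr_eq0 /= => /andP[/eqP GE /eqP ME].
have edge i j : 0 < G i j -> u i = u j.
  move=> Gij; have := psumr_eq0P (fun i _ => sumr_ge0 _ (fun j _ => G0 i j)) GE.
  move=> /(_ i isT) /(psumr_eq0P (fun j _ => G0 i j)) /(_ j isT) /eqP.
  by rewrite mulf_eq0 gt_eqF //= mulf_eq0 orbb subr_eq0 => /eqP.
have cst i j : u i = u j.
  have /connectP[p] := wgraph_connected G i j.
  elim: p i => [|k p IHp] i /=; first by move=> _ ->.
  by move=> /andP[ik pth] /IHp <- //; exact: edge.
have [i mui] : exists i, mu i != 0.
  apply: contrapT => H; apply: mu_neq0; apply/ffunP => i; rewrite ffunE.
  by apply/eqP; apply: contrapT => /negP Hi; apply: H; exists i.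
have /eqP := psumr_eq0P (fun i _ => M0 i) ME (erefl true : xpredT i).
rewrite !mulf_eq0 (negPf mui) (gt_eqF (vweight_gt0 G r i)) orbF orbb /= => /eqP ui.
by apply/eqP/ffunP => j; rewrite (cst j i) ui ffunE.
Qed.

Lemma opA_invopK u : opA G r mu (invop (opA G r mu) u) = u.
Proof.
(* Positive definiteness gives a trivial kernel, which in finite dimension makes the inverse
   two-sided. *)
rewrite -[LHS](lfunE (opA G r mu)) lker0_lfunVK //.
apply/lker0P => x y; rewrite !lfunE => /= xy.
apply/eqP; rewrite -subr_eq0; apply: contraPT (erefl true) => /opA_posdef.
by rewrite linearB /= xy subrr inner0r ltxx.
Qed.

End OperatorA.

(** * Spectral bounds for the semigroup and the forcing term *)

Section Semigroup.
Context {R : realType} {V : finType} {G : wgraph R V} {r : R}.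
Context {mu : {ffun V -> R^o}}.
Context (mu_ge0 : vfun_in `[0, +oo[ mu) (mu_neq0 : mu <> cstV V 0).
Context {J : finType} {a : J -> R} {w : J -> {ffun V -> R^o}}.
Context (Aframe : eigenframe G r (opA G r mu) a w).
Implicit Types (u v f : {ffun V -> R^o}).

Lemma inner_expA t u v : inner G r u (expA G r mu t v) =
  \sum_k expR (- t * a k) * (inner G r (w k) u * inner G r (w k) v).
Proof.
case: (Aframe) => _ _ ->; apply: eq_bigr => k _.
by rewrite (inner_expop _ _ Aframe); ring.
Qed.

(** Linearity and symmetry of e^{-tA} enter only through the spectral sum, a symmetric bilinear form
    in the coefficients. *)
Lemma inner_expAB t u v :
  inner G r (u - v) (expA G r mu t (u - v)) =
  inner G r u (expA G r mu t u) - 2 * inner G r v (expA G r mu t u)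
  + inner G r v (expA G r mu t v).
Proof.
rewrite !inner_expA mulr_sumr -sumrB -big_split; apply: eq_bigr => k _ /=.
by rewrite innerDr innerNr; ring.
Qed.

Lemma inner_expA_le t u : 0 <= t ->
  inner G r u (expA G r mu t u) <= inner G r u u.
Proof.
move=> t0; case: (Aframe) => a0 _ par; rewrite inner_expA par.
apply: ler_sum => k _; rewrite ler_piMl // -?expr2 ?sqr_ge0 //.
by rewrite expR_le1 mulNr oppr_le0 mulr_ge0 // ltW.
Qed.

Lemma inner_expA_ge0 t u : 0 <= inner G r u (expA G r mu t u).
Proof.
rewrite inner_expA sumr_ge0 // => k _.
by rewrite mulr_ge0 ?expR_ge0 // -expr2 sqr_ge0.
Qed.

Lemma inner_expA_eq0 t u : inner G r u (expA G r mu t u) = 0 -> u = 0.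
Proof.
rewrite inner_expA => E; apply: (inner_eq0 G r).
case: (Aframe) => _ _ ->; apply: big1 => k _.
have /eqP : expR (- t * a k) * (inner G r (w k) u * inner G r (w k) u) = 0.
  apply: (psumr_eq0P _ E) => // l _.
  by rewrite mulr_ge0 ?expR_ge0 // -expr2 sqr_ge0.
by rewrite mulf_eq0 gt_eqF ?expR_gt0 //= => /eqP.
Qed.

(** Coefficientwise, 1 - e^{-x} <= x at x = t a_k; Parseval sums the squares. *)
Lemma norm_forcing_le t f : 0 <= t ->
  normV G r (forcing G r mu f t) <= t * normV G r f.
Proof.
move=> t0; case: (Aframe) => a0 wA par.
have wF k : a k * inner G r (w k) (forcing G r mu f t) =
    (1 - expR (- t * a k)) * inner G r (w k) f.
  rewrite -wA opA_invopK // innerDr innerNr (inner_expop _ _ Aframe).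
  by rewrite mulrBl mul1r.
rewrite -[t in leRHS]ger0_norm // -sqrtr_sqr -sqrtrM ?sqr_ge0 //.
rewrite ler_wsqrtr // !par mulr_sumr; apply: ler_sum => k _.
(* Multiplying by a_k^2 exposes the product in [wF] and avoids dividing by a_k. *)
rewrite -!expr2 -(ler_pM2l (exprn_gt0 2 (a0 k))) -!exprMn wF mulrA.
rewrite [in leLHS]exprMn [in leRHS]exprMn ler_wpM2r ?sqr_ge0 //.
have e1 : expR (- t * a k) <= 1 by rewrite expR_le1 mulNr oppr_le0 mulr_ge0 // ltW.
rewrite ler_sqr ?nnegrE ?subr_ge0 ?(mulr_ge0 (ltW (a0 k))) //.
have := expR_ge1Dx (- t * a k).
by lra.
Qed.

End Semigroup.

(** * The subdifferential and the Lyapunov estimates *)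

(** At each vertex [beta] has the sign of every admissible move from [u'] within [0, 1], or is 0. *)
Lemma subdiff_monotone (R : realType) (V : finType) (G : wgraph R V) (r : R)
    (u u' beta : {ffun V -> R^o}) :
  vfun_in `[0, 1] u -> subdiff u' beta -> 0 <= inner G r (u - u') beta.
Proof.
move=> u01 [u'01 ub]; apply: sumr_ge0 => i _; rewrite mulr_ge0 ?powR_ge0 //.
have := u01 i; have := u'01 i; rewrite !ffunE /= !in_itv /=.
case: (ub i) => b0 bm b1 /andP[u'0 u'1] /andP[u0 u1].
have [z|nz] := eqVneq (u' i) 0; first by rewrite z subr0 mulr_ge0 ?b0.
have [one|no] := eqVneq (u' i) 1.
  by rewrite one mulr_le0 ?subr_le0 ?b1.
by rewrite bm ?mulr0 // !lt_def nz u'0 eq_sym no.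
Qed.

Theorem theorem2p12 (R : realType) (V : finType) (G : wgraph R V) (r : R)
    (hr : 0 <= r <= 1) (mu ftilde f : {ffun V -> R^o})
    (hmu : vfun_in `[0, +oo[ mu) (hmu0 : mu <> cstV V 0)
    (hft : vfun_in `[0, 1] ftilde) (hf : f = diagop mu ftilde)
    (eps tau lambda : R) (heps : 0 < eps) (htau : 0 <= tau)
    (hlambda : lambda = tau / eps) (hlambda01 : 0 <= lambda <= 1) :
  (forall u : {ffun V -> R^o}, vfun_in `[0, 1] u ->
     - 2 * tau * normV G r f * normV G r (cstV V 1)
       <= lyapunov G r mu f tau lambda u)
  /\
  (forall u u' : {ffun V -> R^o}, vfun_in `[0, 1] u ->
     (exists2 beta, subdiff u' beta &
        (1 - lambda) *: u' - diffusion G r mu f tau u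
          + (lambda / 2) *: cstV V 1 = lambda *: beta) ->
     [/\ lyapunov G r mu f tau lambda u' <= lyapunov G r mu f tau lambda u,
         lyapunov G r mu f tau lambda u' = lyapunov G r mu f tau lambda u
           <-> u' = u
       & (1 - lambda) * normV G r (u' - u) ^+ 2
           <= lyapunov G r mu f tau lambda u
              - lyapunov G r mu f tau lambda u']).
Proof.
case/andP: hlambda01 => l0 l1.
have [J [a [w Aframe]]] := selfadjoint_eigenframe G r (opA G r mu)
  (opA_sym G r mu) (opA_posdef G r mu hmu hmu0).
split=> [u u01|u u' u01 [beta bu' scheme]].
  (* With F the forcing term, H(u) = lambda <u, 1 - u> + (<u, u> - <u, e^{-tau A} u>) - 2 <u, F>.
     The first two terms are nonnegative; [Fu] bounds the last. *)
  have Eu := inner_expA_le Aframe _ u htau.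
  have Fu : inner G r u (forcing G r mu f tau) <=
      normV G r (cstV V 1) * (tau * normV G r f).
    apply: le_trans (inner_le_norm _ _ _ _) _.
    apply: ler_pM; rewrite ?sqrtr_ge0 ?(norm_forcing_le hmu hmu0 Aframe) //.
    rewrite ler_wsqrtr //; apply: ler_sum => i _; rewrite ler_wpM2r ?powR_ge0 //.
    have := u01 i; rewrite /= in_itv !ffunE /= => /andP[u0 u1].
    by rewrite ler_pM.
  have Ou : 0 <= inner G r u (cstV V 1 - u).
    apply: sumr_ge0 => i _; have := u01 i; rewrite /= in_itv !ffunE /=.
    by move=> /andP[u0 u1]; rewrite !mulr_ge0 ?powR_ge0 ?subr_ge0.
  have := mulr_ge0 l0 Ou; rewrite /lyapunov.
  rewrite !(innerDr, innerNr, innerZr) => lO.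
  by nra.
(* By symmetry of e^{-tau A}, the quadratic terms of H(u) - H(u') regroup into
   the scheme's residual paired with d, which is lambda beta. *)
pose d := u - u'.
pose H := lyapunov G r mu f tau lambda.
have diff : H u - H u' = 2 * lambda * inner G r d beta
    + inner G r d (expA G r mu tau d) + (1 - lambda) * inner G r d d.
  have := congr1 (inner G r d) scheme.
  rewrite /H /lyapunov /d (inner_expAB Aframe).
  rewrite !(innerDl, innerDr, innerNl, innerNr, innerZl, innerZr, opprD).
  rewrite (innerC _ _ u' u).
  by lra.
have db : 0 <= inner G r d beta := subdiff_monotone _ _ _ _ _ _ _ u01 bu'.
have dE : 0 <= inner G r d (expA G r mu tau d) := inner_expA_ge0 Aframe _ _.
have dd : 0 <= (1 - lambda) * inner G r d d.
  by rewrite mulr_ge0 ?subr_ge0 ?inner_ge0.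
have ldb : 0 <= 2 * lambda * inner G r d beta by rewrite !mulr_ge0.
split; rewrite -/(H u) -/(H u').
- by lra.
(* All three terms of [diff] are nonnegative, so equality forces <d, e^{-tau A} d> = 0 and hence d =
   0. *)
- split=> [HH|->//]; apply/esym/eqP; rewrite -subr_eq0 -/d; apply/eqP.
  by apply: (inner_expA_eq0 Aframe tau); lra.
- rewrite /normV sqr_sqrtr ?inner_ge0 // -(opprB u u') innerNl innerNr opprK.
  by rewrite -/d; lra.
Qed.
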